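(* Let $R$ be a $\phi$-ring. If $R$ is a $\phi$-Prüfer ring, then any primary nonnil ideal of $R$ is irreducible. The converse is true if any nonnil prime ideal of $R$ is maximal; that is, if every nonnil prime ideal of $R$ is maximal and every primary nonnil ideal of $R$ is irreducible, then $R$ is a $\phi$-Prüfer ring.
   Context: All rings are commutative with nonzero identity. For a ring $R$, $\mathrm{Nil}(R)$ denotes the ideal of nilpotent elements, $Z(R)$ the set of zerodivisors and $T(R)$ the total quotient ring. A prime ideal $P$ of $R$ is called divided if it is comparable (under inclusion) to every ideal of $R$. $R$ is a $\phi$-ring if $\mathrm{Nil}(R)$ is a divided prime ideal of $R$. An ideal $I$ of $R$ is nonnil if $I \not\subseteq \mathrm{Nil}(R)$. An ideal $\mathfrak q$ is irreducible if $\mathfrak q = I \cap J$ for ideals $I, J$ of $R$ implies $\mathfrak q = I$ or $\mathfrak q = J$. For a $\phi$-ring $R$, let $\phi: T(R) \to R_{\mathrm{Nil}(R)}$ be the ring homomorphism $\phi(a/b) = a/b$ for $a\in R$, $b \in R\setminus Z(R)$; restricted to $R$ it is the ring homomorphism $x \mapsto x/1$, with image the ring $\phi(R)$. A nonnil ideal $I$ of a $\phi$-ring $R$ is $\phi$-invertible if $\phi(I)$ is an invertible ideal of $\phi(R)$, i.e. $\phi(I)\,\phi(I)^{-1} = \phi(R)$ where $\phi(I)^{-1} = \{x \in T(\phi(R)) : x\phi(I) \subseteq \phi(R)\}$. A $\phi$-ring $R$ is $\phi$-Prüfer if every finitely generated nonnil ideal of $R$ is $\phi$-invertible. *)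

(* Defs.v *)
(* Ideals are classical sets, membership being an arbitrary proposition: the
   rings below carry no decidability assumption on their ideals. *)
From HB Require Import structures.
From mathcomp Require Import all_boot all_algebra.
From mathcomp Require Import boolp classical_sets ring.

Set Implicit Arguments.
Unset Strict Implicit.
Unset Printing Implicit Defensive.

Import GRing.Theory.
Local Open Scope classical_set_scope.
Local Open Scope ring_scope.
Local Open Scope quotient_scope.

Section Ideals.
Context {R : comPzRingType}.
Implicit Types (I J P q : set R).

(* Unlike [idealr_closed], this does not require properness. *)
Definition ideal I : Prop :=
  [/\ I 0, (forall x y, I x -> I y -> I (x + y))
         & (forall a x, I x -> I (a * x))].

Definition proper_ideal I : Prop := ideal I /\ ~ I 1.

Definition prime_ideal P : Prop :=
  proper_ideal P /\ (forall x y, P (x * y) -> P x \/ P y).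

Definition maximal_ideal I : Prop :=
  proper_ideal I /\ (forall J, proper_ideal J -> I `<=` J -> J = I).

Definition primary_ideal q : Prop :=
  proper_ideal q /\ (forall x y, q (x * y) -> q x \/ exists n, q (y ^+ n)).

Definition irreducible_ideal q : Prop :=
  ideal q /\
  (forall I J, ideal I -> ideal J -> q = I `&` J -> q = I \/ q = J).

Definition divided_ideal P : Prop :=
  forall I, ideal I -> P `<=` I \/ I `<=` P.

Definition fin_gen_ideal I : Prop :=
  exists s : seq R, I = smallest ideal [set` s].

Definition nilrad : set R := [set x | exists n, x ^+ n = 0].

Definition nonnil I : Prop := ~ (I `<=` nilrad).

Definition zerodivisors : set R := [set a | exists2 x, x != 0 & a * x = 0].

(* The product of two additive subgroups: finite sums of products. *)
Definition prod_set (A B : set R) : set R :=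
  [set x | exists (n : nat) (a b : 'I_n -> R),
     [/\ (forall i, A (a i)), (forall i, B (b i)) & x = \sum_(i < n) a i * b i]].

End Ideals.

Arguments nilrad R : clear implicits.
Arguments zerodivisors R : clear implicits.

(* Localization of R at a multiplicative set S, zero-divisors being allowed
   in S, and the zero ring being a possible result. *)

Record mulset (R : comPzRingType) := MulSet {
  mulset_set :> R -> Prop;
  mulset1 : mulset_set 1;
  mulsetM : forall x y, mulset_set x -> mulset_set y -> mulset_set (x * y) }.

Section Localization.
Variables (R : comPzRingType) (S : mulset R).

Record prefrac := PreFrac {
  prefrac_val : R * R;
  prefrac_denP : `[< S prefrac_val.2 >] }.

HB.instance Definition _ := [isSub for prefrac_val].
HB.instance Definition _ := [Choice of prefrac by <:].

Definition mkpre (a s : R) (sS : S s) : prefrac :=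
  @PreFrac (a, s) (asboolT sS).

Local Notation num x := (prefrac_val x).1.
Local Notation den x := (prefrac_val x).2.

Lemma denP (x : prefrac) : S (den x).
Proof. exact: asboolW (prefrac_denP x). Qed.

Definition eqfrac (x y : prefrac) : bool :=
  `[< exists2 u, S u & u * (num x * den y) = u * (num y * den x) >].

Lemma eqfrac_refl : reflexive eqfrac.
Proof. by move=> x; apply/asboolP; exists 1 => //; exact: mulset1. Qed.

Lemma eqfrac_sym : symmetric eqfrac.
Proof.
by move=> x y; apply/asboolP/asboolP => -[u uS e]; exists u.
Qed.

Lemma eqfrac_trans : transitive eqfrac.
Proof.
move=> y x z /asboolP[u uS e1] /asboolP[v vS e2]; apply/asboolP.
exists (u * v * den y); first by apply: mulsetM; [exact: mulsetM | exact: denP].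
transitivity (u * (num x * den y) * (v * den z)).
  by ring.
rewrite e1; transitivity (v * (num y * den z) * (u * den x)).
  by ring.
by rewrite e2; ring.
Qed.

Canonical eqfrac_equiv := EquivRel eqfrac eqfrac_refl eqfrac_sym eqfrac_trans.

Definition loc := {eq_quot eqfrac}.

HB.instance Definition _ : EqQuotient _ eqfrac loc := EqQuotient.on loc.
HB.instance Definition _ := Choice.on loc.

Definition frac (a s : R) (sS : S s) : loc := \pi_loc (mkpre a sS).

Lemma frac_eqP a s (sS : S s) b t (tS : S t) :
  frac a sS = frac b tS <-> exists2 u, S u & u * (a * t) = u * (b * s).
Proof. by split=> [/eqmodP/asboolP|h]; last by apply/eqmodP/asboolP. Qed.

Lemma fracW (P : loc -> Prop) :
  (forall a s (sS : S s), P (frac a sS)) -> forall x, P x.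
Proof.
move=> h; elim/quotW => -[[a s] sS] /=.
have := h a s (asboolW sS); rewrite /frac /mkpre /=.
by congr (P (\pi _)); apply: val_inj.
Qed.

Definition loc_add (x y : loc) : loc :=
  frac (num (repr x) * den (repr y) + num (repr y) * den (repr x))
       (mulsetM (denP (repr x)) (denP (repr y))).
Definition loc_mul (x y : loc) : loc :=
  frac (num (repr x) * num (repr y)) (mulsetM (denP (repr x)) (denP (repr y))).
Definition loc_opp (x : loc) : loc := frac (- num (repr x)) (denP (repr x)).
Definition to_loc (a : R) : loc := frac a (mulset1 S).

Lemma repr_frac a s (sS : S s) : exists2 u, S u &
  u * (num (repr (frac a sS)) * s) = u * (a * den (repr (frac a sS))).
Proof.
have /eqmodP/asboolP[u uS e] : repr (frac a sS) = mkpre a sS %[mod loc].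
  by rewrite reprK.
by exists u.
Qed.

Lemma loc_addE a s (sS : S s) b t (tS : S t) :
  loc_add (frac a sS) (frac b tS) = frac (a * t + b * s) (mulsetM sS tS).
Proof.
have [u uS e1] := repr_frac a sS; have [v vS e2] := repr_frac b tS.
apply/frac_eqP; exists (u * v); first exact: mulsetM.
move: (repr (frac a sS)) (repr (frac b tS)) e1 e2 => x y e1 e2; rewrite !(mulrDl, mulrDr).
congr (_ + _).
  transitivity (u * (num x * s) * (v * t * den y)).
    by ring.
  by rewrite e1; ring.
transitivity (v * (num y * t) * (u * s * den x)).
  by ring.
by rewrite e2; ring.
Qed.

Lemma loc_mulE a s (sS : S s) b t (tS : S t) :
  loc_mul (frac a sS) (frac b tS) = frac (a * b) (mulsetM sS tS).
Proof.
have [u uS e1] := repr_frac a sS; have [v vS e2] := repr_frac b tS.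
apply/frac_eqP; exists (u * v); first exact: mulsetM.
move: (repr (frac a sS)) (repr (frac b tS)) e1 e2 => x y e1 e2.
transitivity (u * (num x * s) * (v * (num y * t))).
  by ring.
by rewrite e1 e2; ring.
Qed.

Lemma loc_oppE a s (sS : S s) : loc_opp (frac a sS) = frac (- a) sS.
Proof.
have [u uS e1] := repr_frac a sS; apply/frac_eqP; exists u => //.
by rewrite !mulNr !mulrN e1.
Qed.

Lemma frac_eq a s (sS : S s) b t (tS : S t) :
  a * t = b * s -> frac a sS = frac b tS.
Proof.
by move=> e; apply/frac_eqP; exists 1; [exact: mulset1 | rewrite e].
Qed.

Lemma loc_addA : associative loc_add.
Proof.
elim/fracW => a s sS; elim/fracW => b t tS; elim/fracW => c u uS.
rewrite !loc_addE; apply: frac_eq.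
by ring.
Qed.

Lemma loc_addC : commutative loc_add.
Proof.
elim/fracW => a s sS; elim/fracW => b t tS; rewrite !loc_addE.
by apply: frac_eq; rewrite addrC [t * s]mulrC.
Qed.

Lemma loc_add0 : left_id (to_loc 0) loc_add.
Proof.
elim/fracW => a s sS; rewrite loc_addE; apply: frac_eq.
by rewrite mul0r add0r mulr1 mul1r.
Qed.

Lemma loc_addN : left_inverse (to_loc 0) loc_opp loc_add.
Proof.
elim/fracW => a s sS; rewrite loc_oppE loc_addE; apply: frac_eq.
by rewrite mulNr addNr !mul0r.
Qed.

Lemma loc_mulA : associative loc_mul.
Proof.
elim/fracW => a s sS; elim/fracW => b t tS; elim/fracW => c u uS.
by rewrite !loc_mulE; apply: frac_eq; rewrite !mulrA.
Qed.

Lemma loc_mulC : commutative loc_mul.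
Proof.
elim/fracW => a s sS; elim/fracW => b t tS; rewrite !loc_mulE.
by apply: frac_eq; rewrite [b * a]mulrC [t * s]mulrC.
Qed.

Lemma loc_mul1 : left_id (to_loc 1) loc_mul.
Proof.
elim/fracW => a s sS; rewrite loc_mulE.
by apply: frac_eq; rewrite !mul1r.
Qed.

Lemma loc_mulDl : left_distributive loc_mul loc_add.
Proof.
elim/fracW => a s sS; elim/fracW => b t tS; elim/fracW => c u uS.
rewrite !(loc_mulE, loc_addE); apply: frac_eq; ring.
Qed.

HB.instance Definition _ :=
  GRing.isZmodule.Build loc loc_addA loc_addC loc_add0 loc_addN.
HB.instance Definition _ :=
  GRing.Zmodule_isComPzRing.Build loc loc_mulA loc_mulC loc_mul1 loc_mulDl.

End Localization.

Section LocalizationMorphism.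
Context {R : comPzRingType} (S : mulset R).

Lemma to_loc_is_zmod_morphism : zmod_morphism (to_loc S).
Proof.
move=> a b; transitivity (loc_add (to_loc S a) (loc_opp (to_loc S b))) => //.
by rewrite loc_oppE loc_addE; apply: frac_eq; ring.
Qed.

HB.instance Definition _ :=
  GRing.isZmodMorphism.Build R (loc S) (to_loc S) to_loc_is_zmod_morphism.

Lemma to_loc_is_monoid_morphism : monoid_morphism (to_loc S).
Proof.
split=> // a b; transitivity (loc_mul (to_loc S a) (to_loc S b)) => //.
by rewrite loc_mulE; apply: frac_eq; ring.
Qed.

HB.instance Definition _ :=
  GRing.isMonoidMorphism.Build R (loc S) (to_loc S) to_loc_is_monoid_morphism.

End LocalizationMorphism.

Section TotalQuotientRing.
Context {R : comPzRingType}.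

Lemma nzd1 : (~` zerodivisors R) 1.
Proof. by case=> x /eqP x0; rewrite mul1r. Qed.

Lemma nzdM (a b : R) : (~` zerodivisors R) a -> (~` zerodivisors R) b ->
  (~` zerodivisors R) (a * b).
Proof.
move=> ha hb [x x0 abx]; apply: ha; exists (b * x); last by rewrite mulrA.
by apply/eqP => bx; apply: hb; exists x.
Qed.

Definition nzd_mulset : mulset R := MulSet nzd1 nzdM.

End TotalQuotientRing.

Definition tqr (R : comPzRingType) := loc (@nzd_mulset R).
HB.instance Definition _ (R : comPzRingType) :=
  GRing.ComPzRing.on (tqr R).
Definition to_tqr {R : comPzRingType} : {rmorphism R -> tqr R} :=
  to_loc (@nzd_mulset R).

Section PrimeComplement.
Context {R : comPzRingType} {P : set R} (primeP : prime_ideal P).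

Lemma prime_compl1 : (~` P) 1. Proof. exact: primeP.1.2. Qed.

Lemma prime_complM (a b : R) : (~` P) a -> (~` P) b -> (~` P) (a * b).
Proof. by move=> na nb /(primeP.2 _ _) []. Qed.

Definition prime_compl : mulset R := MulSet prime_compl1 prime_complM.

End PrimeComplement.

(* The image of a ring morphism, as a ring of its own. *)
Section ImageRing.
Context {A B : comPzRingType} (f : {rmorphism A -> B}).

Record im_ring := ImRing { im_val : B; im_valP : `[< range f im_val >] }.

HB.instance Definition _ := [isSub for im_val].
HB.instance Definition _ := [Choice of im_ring by <:].

Lemma im_subring_closed : subring_closed (fun y : B => `[< range f y >]).
Proof.
split; first by apply/asboolP; exists 1 => //; exact: rmorph1.
  move=> _ _ /asboolP[x _ <-] /asboolP[y _ <-]; apply/asboolP.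
  by exists (x - y) => //; exact: rmorphB.
move=> _ _ /asboolP[x _ <-] /asboolP[y _ <-]; apply/asboolP.
by exists (x * y) => //; exact: rmorphM.
Qed.

HB.instance Definition _ :=
  GRing.SubChoice_isSubComPzRing.Build B _ im_ring im_subring_closed.

Definition to_im (x : A) : im_ring := ImRing (asboolT (imageT f x)).

Lemma to_im_is_zmod_morphism : zmod_morphism to_im.
Proof. by move=> x y; apply: val_inj; rewrite /= rmorphB. Qed.

HB.instance Definition _ :=
  GRing.isZmodMorphism.Build A im_ring to_im to_im_is_zmod_morphism.

Lemma to_im_is_monoid_morphism : monoid_morphism to_im.
Proof.
by split=> [|x y]; apply: val_inj; rewrite /= ?rmorph1 ?rmorphM.
Qed.

HB.instance Definition _ :=
  GRing.isMonoidMorphism.Build A im_ring to_im to_im_is_monoid_morphism.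

End ImageRing.

Section InvertibleIdeal.
Context {A : comPzRingType}.

Definition inv_ideal (J : set A) : set (tqr A) :=
  [set x | forall a, J a -> range to_tqr (x * to_tqr a)].

Definition invertible_ideal (J : set A) : Prop :=
  prod_set (to_tqr @` J) (inv_ideal J) = range to_tqr.

End InvertibleIdeal.

Definition phi_ring (R : comNzRingType) : Prop :=
  prime_ideal (nilrad R) /\ divided_ideal (nilrad R).

Section PhiRing.
Context {R : comNzRingType} (hR : phi_ring R).

Definition loc_nil := loc (prime_compl hR.1).
HB.instance Definition _ := GRing.ComPzRing.on loc_nil.

(* The restriction to R of phi : T(R) -> R_Nil(R), that is x |-> x / 1. *)
Definition phi : {rmorphism R -> loc_nil} := to_loc (prime_compl hR.1).

Definition phi_img := im_ring phi.
HB.instance Definition _ := GRing.ComPzRing.on phi_img.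

Definition phi_ideal (I : set R) : set phi_img := to_im phi @` I.

Definition phi_invertible (I : set R) : Prop :=
  nonnil I /\ invertible_ideal (phi_ideal I).

Definition phi_prufer : Prop :=
  forall I, ideal I -> fin_gen_ideal I -> nonnil I -> phi_invertible I.

End PhiRing.

(* Main.v *)
Require Import Defs.
From HB Require Import structures.
From mathcomp Require Import all_boot all_algebra.
From mathcomp Require Import boolp classical_sets.
From mathcomp Require Import ring.

(** Nilpotents lie in every nonnil ideal because [nilrad R] is divided, so
    every relation below may be read modulo [nilrad R], where [R] becomes a
    domain; [phi] changes nothing to this picture, since its kernel consists of
    nilpotents and it makes nonnil elements regular.  The theorem is the
    [phi]-version of: in a Prüfer domain nonzero primary ideals are
    irreducible, and conversely in dimension one.

    Direct implication.  If [q] is primary and nonnil with [q = I `&` J], and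
    [a] in [I], [b] in [J] lie outside [q], then invertibility of the ideal
    [(a, b)] says that, up to nilpotents, [s + t = 1], [s * b = c * a] and
    [t * a = d * b] ([rel_product_pair]).  The last two elements lie
    in [I `&` J = q].  As [q] is primary and misses [a], it contains a power
    of [t]; as [b] is congruent to [t * b] modulo [q], it then contains [b].

    Converse.  Let [M] be a nonnil prime.  If nonnil primes are maximal, an
    ideal which is nonnil, proper and saturated with respect to the complement
    of [M] has [M] as its radical and is therefore primary
    ([saturated_primary]).  This applies to the intersection of the
    saturations of [(a)] and [(b)], whose irreducibility makes [a] and [b]
    comparable for divisibility locally at [M] ([locally_comparable]).  Hence a
    finitely generated nonnil ideal [I] is locally generated by one of its
    elements ([locally_principal]).  The multipliers [s] with
    [s * I `<=` (a)] for some nonnil [a] in [I] lie in the ideal of those [r]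
    that belong to the product of [I] and its inverse; so no prime contains
    this ideal, which must contain [1]. *)

Set Implicit Arguments.
Unset Strict Implicit.
Unset Printing Implicit Defensive.

Import GRing.Theory.
Local Open Scope classical_set_scope.
Local Open Scope ring_scope.

(** * Ideals *)

Section IdealTheory.
Context {R : comPzRingType}.
Implicit Types (I J q M : set R) (a b x : R).

Lemma idealN I x : ideal I -> I x -> I (- x).
Proof. by case=> _ _ IM Ix; rewrite -mulN1r; exact: IM. Qed.

Lemma idealB I x y : ideal I -> I x -> I y -> I (x - y).
Proof.
by move=> idI Ix Iy; case: (idI) => _ ID _; apply: ID => //; exact: idealN.
Qed.

Lemma idealI I J : ideal I -> ideal J -> ideal (I `&` J).
Proof.
move=> [I0 ID IM] [J0 JD JM]; split=> //.
- by move=> x y [Ix Jx] [Iy Jy]; split; [exact: ID | exact: JD].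
- by move=> a x [Ix Jx]; split; [exact: IM | exact: JM].
Qed.

Lemma ideal_smallest (G : set R) : ideal (smallest ideal G).
Proof.
split=> [I [[]] //|x y Gx Gy I IP|a x Gx I IP].
  by case: (IP) => -[_ ID _] _; apply: ID; [exact: Gx | exact: Gy].
by case: (IP) => -[_ _ IM] _; apply: IM; exact: Gx.
Qed.

Definition principal a : set R := [set x | exists c, x = c * a].

Lemma principal_ideal a : ideal (principal a).
Proof.
split=> [|_ _ [c ->] [d ->]|x _ [c ->]].
- by exists 0; rewrite mul0r.
- by exists (c + d); rewrite mulrDl.
- by exists (x * c); rewrite mulrA.
Qed.

Lemma principal_id a : principal a a.
Proof. by exists 1; rewrite mul1r. Qed.

Lemma smallest_pair a b x :
  smallest ideal [set` [:: a; b]] x -> exists u v, x = u * a + v * b.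
Proof.
pose J : set R := [set x | exists u v, x = u * a + v * b].
suff idJ : ideal J.
  apply: (@smallest_sub _ _ _ J idJ) => y /=.
  rewrite !inE => /orP[]/eqP->.
    by exists 1, 0; ring.
  by exists 0, 1; ring.
split=> [|_ _ [u [v ->]] [u' [v' ->]]|z _ [u [v ->]]].
- by exists 0, 0; ring.
- by exists (u + u'), (v + v'); ring.
- by exists (z * u), (z * v); ring.
Qed.

(** Krull's lemma: an ideal maximal among those containing [q] and missing [S]
    is prime. *)
Lemma prime_avoiding (S : mulset R) q :
  ideal q -> (forall x, S x -> ~ q x) ->
  exists P, [/\ prime_ideal P, q `<=` P & forall x, S x -> ~ P x].
Proof.
move=> idq Sq.
(* Zorn is applied to the sets A with q `|` A an ideal rather than to the
   ideals containing q, so that the empty chain has an upper bound too. *)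
pose C : set (set R) := [set A | ideal (q `|` A) /\
                                 forall x, S x -> ~ (q `|` A) x].
have [F FC Ftot|A [[idA SA] maxA]] := @Zorn_bigcup R C.
  have step A x : F A -> (q `|` A) x -> (q `|` \bigcup_(X in F) X) x.
    by move=> FA [qx|Ax]; [left | right; exists A].
  split=> [|x Sx [qx|[A FA Ax]]]; last 2 first.
  - exact: Sq qx.
  - by case: (FC _ FA) => _ /(_ x Sx); apply; right.
  have addF A x y : F A -> (q `|` A) x -> (q `|` A) y ->
      (q `|` \bigcup_(X in F) X) (x + y).
    move=> FA Ax Ay; apply: (step A) => //.
    by case: (FC _ FA) => -[_ AD _] _; exact: AD.
  case: (idq) => q0 qD qM; split=> [|x y|a x].
  - by left.
  - case=> [qx|[A FA Ax]] [qy|[B FB By]].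
    + by left; exact: qD.
    + by apply: (addF B) => //; [left | right].
    + by apply: (addF A) => //; [right | left].
    + case: (Ftot _ _ FA FB) => sub.
        by apply: (addF B) => //; right => //; exact: sub.
      by apply: (addF A) => //; right => //; exact: sub.
  - case=> [qx|[A FA Ax]]; first by left; exact: qM.
    apply: (step A) => //; case: (FC _ FA) => -[_ _ AM] _.
    by apply: AM; right.
set P := q `|` A in idA SA.
case: (idA) => P0 PD PM.
have meetS z : ~ P z -> exists p c, P p /\ S (p + c * z).
  move=> Pz; apply: contrapT => nS.
  pose B : set R := [set w | exists p c, P p /\ w = p + c * z].
  have PB : P `<=` B by move=> p Pp; exists p, 0; split=> //; ring.
  have qB : q `|` B = B.
    by apply/seteqP; split=> w; [case=> // qw; apply: PB; left | right].
  apply: (maxA B).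
    split=> [|BA]; first by move=> w Aw; apply: PB; right.
    by apply: Pz; right; apply: BA; exists 0, 1; split=> //; ring.
  suff idB : ideal B.
    split; rewrite qB // => w Sw [p [c [Pp wE]]].
    by apply: nS; exists p, c; rewrite -wE.
  split=> [|_ _ [p [c [Pp ->]]] [p' [c' [Pp' ->]]]|d _ [p [c [Pp ->]]]].
  - exact: PB.
  - by exists (p + p'), (c + c'); split; [exact: PD | ring].
  - by exists (d * p), (d * c); split; [exact: PM | ring].
exists P; split=> //; last by move=> x; left.
split; first by split=> //; apply: SA; exact: mulset1.
move=> x y Pxy; apply: contrapT => /not_orP[Px Py].
have [p [c [Pp Sx]]] := meetS _ Px; have [p' [c' [Pp' Sy]]] := meetS _ Py.
apply: (SA _ (mulsetM Sx Sy)).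
have -> : (p + c * x) * (p' + c' * y) =
    (p' + c' * y) * p + (c * x * p' + c * c' * (x * y)) by ring.
by apply: (PD); [exact: PM | apply: PD; exact: PM].
Qed.

Lemma proper_sub_prime I :
  Defs.proper_ideal I -> exists2 P, prime_ideal P & I `<=` P.
Proof.
case=> idI I1.
have S1M (x y : R) : x = 1 -> y = 1 -> x * y = 1.
  by move=> -> ->; rewrite mulr1.
have [x -> //|P [primeP IP _]] :=
  @prime_avoiding (@MulSet R (fun x => x = 1) erefl S1M) I idI.
by exists P.
Qed.

(** [saturation M I] is the contraction to [R] of the ideal generated by [I]
    in the localization of [R] at the prime [M]. *)
Definition saturation M I : set R := [set x | exists2 s, ~ M s & I (s * x)].

Section Saturation.
Variables (M I : set R).
Hypothesis primeM : prime_ideal M.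
Hypothesis idI : ideal I.

Lemma saturation_sub : I `<=` saturation M I.
Proof. by move=> x Ix; exists 1; [exact: primeM.1.2 | rewrite mul1r]. Qed.

Lemma saturation_ideal : ideal (saturation M I).
Proof.
have [I0 ID IM] := idI; split=> [|x y [s Ms Isx] [t Mt Ity]|a x [s Ms Isx]].
- exact: saturation_sub.
- exists (s * t); first by case/primeM.2.
  have -> : s * t * (x + y) = t * (s * x) + s * (t * y) by ring.
  by apply: ID; exact: IM.
- by exists s => //; rewrite mulrCA; exact: IM.
Qed.

Lemma saturation_saturated s x :
  ~ M s -> saturation M I (s * x) -> saturation M I x.
Proof.
move=> Ms [t Mt Itsx]; exists (t * s); last by rewrite -mulrA.
by case/primeM.2.
Qed.

End Saturation.

End IdealTheory.

(** * Nonnil ideals of a phi-ring *)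

Section PhiIdeals.
Context {R : comNzRingType} (hR : phi_ring R).
Implicit Types (I J q M : set R) (a b x : R).

Lemma nonnil_elt I : nonnil I -> exists2 a, I a & ~ nilrad R a.
Proof.
move=> nnI; apply: contrapT => h; apply: nnI => a Ia.
by apply: contrapT => na; apply: h; exists a.
Qed.

Lemma nonnilI I a : I a -> ~ nilrad R a -> nonnil I.
Proof. by move=> Ia na sub; apply: na; exact: sub. Qed.

Lemma nilrad_sub I : ideal I -> nonnil I -> nilrad R `<=` I.
Proof. by move=> idI nnI; case: (hR.2 _ idI). Qed.

Lemma nilrad_principal a x : ~ nilrad R a -> nilrad R x -> principal a x.
Proof.
move=> na; apply: nilrad_sub; first exact: principal_ideal.
by apply: nonnilI na; exact: principal_id.
Qed.

(** ** Comparison at a nonnil prime *)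

Section DimensionOne.
Hypothesis maxP : forall P : set R, prime_ideal P -> nonnil P -> maximal_ideal P.

(** If some [y] in [M] had no power in [q], Krull's lemma applied to the
    elements [s * y ^+ n] with [s] outside [M] would give a prime between [q]
    and [M] without [y]; but a nonnil prime inside [M] is equal to [M]. *)
Lemma saturated_primary M q : prime_ideal M -> Defs.proper_ideal q -> nonnil q ->
  (forall s x, ~ M s -> q (s * x) -> q x) -> primary_ideal q.
Proof.
move=> primeM pq nnq satq; split=> // x y qxy.
have [qx|nqx] := pselect (q x); [by left | right].
have My : M y.
  by apply: contrapT => My; apply: nqx; apply: (satq y) => //; rewrite mulrC.
apply: contrapT => nqy.
pose S z := exists2 s, ~ M s & exists n, z = s * y ^+ n.
have S1 : S 1 by exists 1; [exact: primeM.1.2 | exists 0%N; rewrite mulr1].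
have SM u v : S u -> S v -> S (u * v).
  move=> [s Ms [n ->]] [t Mt [m ->]]; exists (s * t); first by case/primeM.2.
  by exists (n + m)%N; rewrite exprD; ring.
have [_ [s Ms [n ->]] qsyn|P [primeP qP SP]] :=
  @prime_avoiding _ (MulSet S1 SM) q pq.1.
  by apply: nqy; exists n; exact: satq qsyn.
have PM : P `<=` M.
  move=> z Pz; apply: contrapT => Mz; apply: (SP z) => //.
  by exists z => //; exists 0%N; rewrite mulr1.
have nnP : nonnil P by have [a /qP Pa] := nonnil_elt nnq; exact: nonnilI Pa.
have EMP : M = P by apply: (maxP primeP nnP).2 => //; exact: primeM.1.
apply: (SP y); last by rewrite -EMP.
by exists 1; [exact: primeM.1.2 | exists 1%N; rewrite mul1r].
Qed.

Hypothesis irr :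
  forall q : set R, primary_ideal q -> nonnil q -> irreducible_ideal q.

Lemma locally_comparable M a b : prime_ideal M ->
  ~ nilrad R a -> ~ nilrad R b ->
  exists2 s, ~ M s & principal a (s * b) \/ principal b (s * a).
Proof.
move=> primeM na nb.
pose A := saturation M (principal a); pose B := saturation M (principal b).
have idA : ideal A := saturation_ideal primeM (principal_ideal a).
have idB : ideal B := saturation_ideal primeM (principal_ideal b).
suff [Ab|Ba] : A b \/ B a.
- by case: Ab => s Ms sb; exists s => //; left.
- by case: Ba => s Ms sa; exists s => //; right.
have Aa : A a by apply: saturation_sub => //; exact: principal_id.
have Bb : B b by apply: saturation_sub => //; exact: principal_id.
have [[A1 _]|AB1] := pselect ((A `&` B) 1).
  by left; rewrite -[b]mulr1; case: idA => _ _; apply.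
have nnAB : nonnil (A `&` B).
  apply: (@nonnilI _ (a * b)); last by case/hR.1.2.
  split; last by case: idB => _ _; apply.
  by rewrite mulrC; case: idA => _ _; apply.
have primAB : primary_ideal (A `&` B).
  apply: (saturated_primary primeM) => //; first by split=> //; exact: idealI.
  by move=> s x Ms [Ax Bx]; split; exact: saturation_saturated Ms _.
have [_ /(_ A B idA idB erefl)[E|E]] := irr primAB nnAB.
- by right; have [] : (A `&` B) a by rewrite E.
- by left; have [] : (A `&` B) b by rewrite E.
Qed.

(** Among finitely many nonnil elements, one divides all the others locally at
    [M]; the nilpotent ones are divisible by it anyway. *)
Lemma locally_principal M (l : seq R) : prime_ideal M ->
  {in l, forall x, nilrad R x} \/
  exists a s, [/\ a \in l, ~ nilrad R a, ~ M s
                & {in l, forall x, principal a (s * x)}].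
Proof.
move=> primeM; have M1 := primeM.1.2.
have mulP c u (p : R) : principal p u -> principal p (c * u).
  by case: (principal_ideal p) => _ _; apply.
elim: l => [|x l [nill|[a [s [la na Ms las]]]]]; first by left.
- have [nx|nx] := pselect (nilrad R x).
    by left=> y; rewrite inE => /orP[/eqP->|/nill].
  right; exists x, 1; split=> //; first exact: mem_head.
  move=> y; rewrite mul1r inE => /orP[/eqP->|/nill]; first exact: principal_id.
  exact: nilrad_principal.
have [nx|nx] := pselect (nilrad R x).
  right; exists a, s; split=> //; first by rewrite inE la orbT.
  move=> y; rewrite inE => /orP[/eqP->|/las //].
  by apply: mulP; exact: nilrad_principal.
right; have [t Mt [tx|ta]] := locally_comparable primeM na nx.
  exists a, (s * t); split=> //; first by rewrite inE la orbT.
    by case/primeM.2.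
  move=> y; rewrite inE => /orP[/eqP->|/las lay].
    by rewrite -mulrA; exact: mulP.
  by rewrite [s * t]mulrC -mulrA; exact: mulP.
exists x, (s * t); split=> //; first exact: mem_head.
  by case/primeM.2.
move=> y; rewrite inE => /orP[/eqP->|/las [c sy]].
  by apply: mulP; exact: principal_id.
by rewrite [s * t]mulrC -mulrA sy mulrCA; exact: mulP.
Qed.

End DimensionOne.

End PhiIdeals.

(** * Invertibility in the total quotient ring of phi(R) *)

Section Products.
Context {R : comPzRingType} (A B : set R).

Lemma prod_set0 : prod_set A B 0.
Proof.
by exists 0%N, (fun=> 0), (fun=> 0); split=> [[]|[]|] //; rewrite big_ord0.
Qed.

Lemma prod_set_mul a b : A a -> B b -> prod_set A B (a * b).
Proof. by exists 1%N, (fun=> a), (fun=> b); split=> //; rewrite big_ord1. Qed.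

Lemma prod_setD x y : prod_set A B x -> prod_set A B y -> prod_set A B (x + y).
Proof.
move=> [n [a [b [Aa Bb ->]]]] [m [c [d [Ac Bd ->]]]].
exists (n + m)%N.
exists (fun i => match split i with inl j => a j | inr j => c j end).
exists (fun i => match split i with inl j => b j | inr j => d j end).
split=> [i|i|]; [by case: split | by case: split |].
rewrite big_split_ord /=; congr (_ + _); apply: eq_bigr => i _.
  by rewrite -[lshift _ _]/(unsplit (inl i)) unsplitK.
by rewrite -[rshift _ _]/(unsplit (inr i)) unsplitK.
Qed.

Lemma prod_setMr c x : (forall b, B b -> B (c * b)) ->
  prod_set A B x -> prod_set A B (c * x).
Proof.
move=> BM [n [a [b [Aa Bb ->]]]]; exists n, a, (fun i => c * b i).
split=> // [i|]; first exact: BM.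
by rewrite mulr_sumr; apply: eq_bigr => i _; rewrite mulrCA.
Qed.

End Products.

(** Invertibility of the ideal generated by [f @` I] in the subring [range f] of
    [T], with every quantifier over [range f] pulled back to [R]. *)
Section RelativeInverse.
Context {R T : comPzRingType} (f : {rmorphism R -> T}).
Implicit Types (I : set R) (a b r : R).

Definition rel_inverse I : set T :=
  [set x | forall r, I r -> range f (x * f r)].

Definition rel_product I : set T := prod_set (f @` I) (rel_inverse I).

Lemma rel_inverse0 I : rel_inverse I 0.
Proof. by move=> r _; exists 0 => //; rewrite rmorph0 mul0r. Qed.

Lemma rel_inverseD I x y :
  rel_inverse I x -> rel_inverse I y -> rel_inverse I (x + y).
Proof.
move=> Ix Iy r Ir; have [c _ cE] := Ix r Ir; have [d _ dE] := Iy r Ir.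
by exists (c + d) => //; rewrite rmorphD mulrDl cE dE.
Qed.

Lemma rel_inverseM I r x : rel_inverse I x -> rel_inverse I (f r * x).
Proof.
move=> Ix r' /Ix[c _ cE]; exists (r * c) => //.
by rewrite rmorphM -mulrA -cE.
Qed.

Lemma rel_product_ideal I : ideal [set r | rel_product I (f r)].
Proof.
split=> [|x y Ix Iy|a x Ix]; rewrite /mkset.
- by rewrite rmorph0; exact: prod_set0.
- by rewrite rmorphD; exact: prod_setD.
- by rewrite rmorphM; apply: prod_setMr => // b; exact: rel_inverseM.
Qed.

Lemma rel_productP I : rel_product I = range f <-> rel_product I 1.
Proof.
split=> [->|I1]; first by exists 1 => //; exact: rmorph1.
apply/seteqP; split=> [_ [n [a [b [Ia Ib ->]]]]|_ [r _ <-]].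
  elim/big_ind: _ => [|_ _ [r _ <-] [r' _ <-]|i _].
  - by exists 0 => //; exact: rmorph0.
  - by exists (r + r') => //; exact: rmorphD.
  - by have [r Ir <-] := Ia i; rewrite mulrC; exact: Ib.
have [_ _ /(_ r 1)] := rel_product_ideal I.
by rewrite /mkset mulr1 rmorph1; apply.
Qed.

(** The element [s / a] of the inverse of [I] exhibits [s] as [a * (s / a)]. *)
Lemma rel_product_colon I a s w : I a -> w * f a = 1 ->
  (forall x, I x -> principal a (s * x)) -> rel_product I (f s).
Proof.
move=> Ia wa sI.
have -> : f s = f a * (f s * w) by rewrite mulrCA [_ * w]mulrC wa mulr1.
apply: prod_set_mul; first by exists a.
move=> x /sI[c sx]; exists c => //.
by rewrite mulrAC -rmorphM sx rmorphM -mulrA [_ * w]mulrC wa mulr1.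
Qed.

(** Writing [1] in the product as [a * x + b * y] with [x] and [y] in the
    inverse, one takes [s = x * a], [c = x * b], [d = y * a], [t = y * b]. *)
Lemma rel_product_pair a b :
  rel_product (smallest ideal [set` [:: a; b]]) 1 ->
  exists s t c d, [/\ f (s + t) = f 1, f (s * b) = f (c * a)
                    & f (t * a) = f (d * b)].
Proof.
set I := smallest _ _ => -[n [u [v [Iu Iv sum1]]]].
have Ia : I a by apply: sub_gen_smallest; rewrite /= !inE eqxx.
have Ib : I b by apply: sub_gen_smallest; rewrite /= !inE eqxx orbT.
have [x [y [Ix Iy xy1]]] : exists x y,
    [/\ rel_inverse I x, rel_inverse I y & 1 = f a * x + f b * y].
  rewrite sum1.
  elim/big_ind: _ => [|_ _ [x [y [Ix Iy ->]]] [x' [y' [Ix' Iy' ->]]]|i _].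
  - by exists 0, 0; rewrite !mulr0 addr0; split=> //; exact: rel_inverse0.
  - by exists (x + x'), (y + y'); split; [exact: rel_inverseD.. | ring].
  - have [r /smallest_pair[al [be ->]] <-] := Iu i.
    exists (f al * v i), (f be * v i); split; [exact: rel_inverseM.. |].
    by rewrite rmorphD !rmorphM; ring.
have [s _ sE] := Ix a Ia; have [c _ cE] := Ix b Ib.
have [d _ dE] := Iy a Ia; have [t _ tE] := Iy b Ib.
exists s, t, c, d; split.
- by rewrite rmorphD rmorph1 sE tE xy1; ring.
- by rewrite !rmorphM sE cE; ring.
- by rewrite !rmorphM tE dE; ring.
Qed.

End RelativeInverse.

Section TotalQuotients.
Context {A : comPzRingType}.

Lemma to_tqr_inj (a b : A) : to_tqr a = to_tqr b -> a = b.
Proof.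
move/frac_eqP=> [u uS e]; apply/eqP; rewrite -subr_eq0; apply/eqP.
apply: contrapT => /eqP ab; apply: uS; exists (a - b) => //.
by rewrite mulrBr; move: e; rewrite !mulr1 => ->; rewrite subrr.
Qed.

Lemma to_tqr_inv (a : A) : (~` zerodivisors A) a ->
  exists w : tqr A, w * to_tqr a = 1.
Proof.
move=> ha; exists (@Defs.frac _ nzd_mulset 1 a ha).
apply: (etrans (loc_mulE _ _ _ _)).
by apply: frac_eq; rewrite !mul1r !mulr1.
Qed.

End TotalQuotients.

Section PhiInvertible.
Context {R : comNzRingType} (hR : phi_ring R).
Implicit Types (I : set R) (a b r : R).

Definition to_tqr_phi : {rmorphism R -> tqr (phi_img hR)} :=
  to_tqr \o to_im (phi hR).

Local Notation iota := to_tqr_phi.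

Lemma to_im_phi_eq0 r : to_im (phi hR) r = 0 <->
  exists2 u, ~ nilrad R u & u * r = 0.
Proof.
split=> [/(congr1 val)|[u uN ur]].
  move=> /(@frac_eqP _ (prime_compl hR.1) r 1 _ 0 1)[u uN].
  by rewrite !mulr1 mulr0; exists u.
apply/val_inj/(@frac_eqP _ (prime_compl hR.1) r 1 _ 0 1).
by exists u => //; rewrite !mulr1 mulr0.
Qed.

Lemma to_tqr_phi_eq r r' : iota r = iota r' -> nilrad R (r - r').
Proof.
move=> /to_tqr_inj E.
have : to_im (phi hR) (r - r') = 0 by rewrite rmorphB /= E subrr.
move/to_im_phi_eq0=> [u uN ur]; case: (hR.1.2 u (r - r')) => //.
by rewrite ur; case: hR.1 => -[[]].
Qed.

(** A relation [u * (a * r) = 0] with [u] nonnil also kills [r / 1], since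
    [u * a] is nonnil: the image of [a] is regular in [phi(R)]. *)
Lemma to_tqr_phi_inv a : ~ nilrad R a -> exists w, w * iota a = 1.
Proof.
move=> na; apply: to_tqr_inv => -[[x xP] /eqP x0 ax]; apply: x0.
have [r _ rx] := asboolW xP.
have Er : ImRing xP = to_im (phi hR) r by apply: val_inj.
move: ax; rewrite Er => /eqP; rewrite -rmorphM => /eqP/to_im_phi_eq0[u uN uar].
apply/to_im_phi_eq0; exists (u * a); last by rewrite -mulrA.
by case/hR.1.2.
Qed.

Lemma range_to_tqr_phi : range iota = range to_tqr.
Proof.
apply/seteqP; split=> [_ [r _ <-]|_ [[y yP] _ <-]]; first exact: imageT.
have [r _ ry] := asboolW yP; exists r => //.
by have -> : ImRing yP = to_im (phi hR) r by apply: val_inj.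
Qed.

Lemma rel_inverse_phiE I : inv_ideal (@phi_ideal _ hR I) = rel_inverse iota I.
Proof.
apply/seteqP; split=> x Ix r.
  by move=> Ir; rewrite range_to_tqr_phi; apply: Ix; exists r.
by move=> [r' Ir' <-]; rewrite -range_to_tqr_phi; exact: Ix.
Qed.

Lemma phi_invertibleP I :
  phi_invertible hR I <-> nonnil I /\ rel_product iota I 1.
Proof.
rewrite -rel_productP /phi_invertible /invertible_ideal rel_inverse_phiE.
by rewrite -range_to_tqr_phi /phi_ideal image_comp.
Qed.

End PhiInvertible.

(** * The equivalence *)

Section Main.
Context {R : comNzRingType} (hR : phi_ring R).

Lemma phi_prufer_irreducible (q : set R) :
  phi_prufer hR -> primary_ideal q -> nonnil q -> irreducible_ideal q.
Proof.
move=> prufer [[idq q1] primq] nnq; split=> // I J idI idJ qIJ.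
apply: contrapT => /not_orP[qI qJ].
have [a Ia qa] : exists2 a, I a & ~ q a.
  apply: contrapT => h; apply: qI; apply/seteqP.
  split; first by rewrite qIJ => x [].
  by move=> x Ix; apply: contrapT => qx; apply: h; exists x.
have [b Jb qb] : exists2 b, J b & ~ q b.
  apply: contrapT => h; apply: qJ; apply/seteqP.
  split; first by rewrite qIJ => x [].
  by move=> x Jx; apply: contrapT => qx; apply: h; exists x.
have Nq := nilrad_sub hR idq nnq.
have na : ~ nilrad R a by move/Nq.
case: (idq) => q0 qD qM; case: (idI) => _ ID IM; case: (idJ) => _ JD JM.
have /phi_invertibleP[_ /rel_product_pair[s [t [c [d []]]]]] :
    phi_invertible hR (smallest ideal [set` [:: a; b]]).
  apply: prufer; [exact: ideal_smallest | by exists [:: a; b] |].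
  by apply: nonnilI na; apply: sub_gen_smallest; rewrite /= !inE eqxx.
move=> /to_tqr_phi_eq st1 /to_tqr_phi_eq sb /to_tqr_phi_eq ta.
have [qI' qJ'] : q `<=` I /\ q `<=` J by rewrite qIJ; split=> x [].
have qsb : q (s * b).
  rewrite qIJ; split; last exact: JM.
  have -> : s * b = (s * b - c * a) + c * a by ring.
  by apply: ID; [apply: qI'; exact: Nq | exact: IM].
have qta : q (t * a).
  rewrite qIJ; split; first exact: IM.
  have -> : t * a = (t * a - d * b) + d * b by ring.
  by apply: JD; [apply: qJ'; exact: Nq | exact: JM].
have [//|[n qtn]] : q a \/ exists n, q (t ^+ n) by apply: primq; rewrite mulrC.
(* Modulo q, b is fixed by multiplication by t, hence by all its powers. *)
have qbtb : q (b - t * b).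
  have -> : b - t * b = s * b - b * (s + t - 1) by ring.
  by apply: idealB => //; apply: qM; exact: Nq.
have qbtnb k : q (b - t ^+ k * b).
  elim: k => [|k IH]; first by rewrite expr0 mul1r subrr.
  have -> : b - t ^+ k.+1 * b = (b - t * b) + t * (b - t ^+ k * b).
    by rewrite exprS; ring.
  by apply: qD => //; exact: qM.
apply: qb; have -> : b = (b - t ^+ n * b) + b * t ^+ n by ring.
by apply: qD => //; exact: qM.
Qed.

Lemma irreducible_phi_prufer :
  (forall P : set R, prime_ideal P -> nonnil P -> maximal_ideal P) ->
  (forall q : set R, primary_ideal q -> nonnil q -> irreducible_ideal q) ->
  phi_prufer hR.
Proof.
move=> maxP irr I idI [l lI] nnI; apply/phi_invertibleP; split=> //.
rewrite -(rmorph1 (to_tqr_phi hR)); apply: contrapT => I1.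
have [M primeM CM] := proper_sub_prime (conj (rel_product_ideal (to_tqr_phi hR) I) I1).
have genI (J : set R) : ideal J -> (forall x, x \in l -> J x) -> I `<=` J.
  by move=> idJ lJ; rewrite lI; exact: smallest_sub.
have [lN|[a [s [la na Ms las]]]] := locally_principal hR maxP irr l primeM.
  by apply: nnI; apply: genI => //; exact: hR.1.1.1.
have [w wa] := to_tqr_phi_inv hR na.
apply/Ms/CM; apply: (rel_product_colon _ wa).
  by rewrite lI; exact: sub_gen_smallest.
case: (principal_ideal a) => p0 pD pM.
apply: (genI [set x | principal a (s * x)]) => //.
split=> [|x y sx sy|c x sx] /=; first by rewrite mulr0.
  by rewrite mulrDr; exact: pD.
by rewrite mulrCA; exact: pM.
Qed.

End Main.

Theorem theorem2p15 (R : comNzRingType) (hR : phi_ring R) :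
  (phi_prufer hR ->
     forall q : set R, primary_ideal q -> nonnil q -> irreducible_ideal q) /\
  ((forall P : set R, prime_ideal P -> nonnil P -> maximal_ideal P) ->
   (forall q : set R, primary_ideal q -> nonnil q -> irreducible_ideal q) ->
   phi_prufer hR).
Proof.
split; last exact: irreducible_phi_prufer.
by move=> prufer q; exact: phi_prufer_irreducible.
Qed.
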